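(* Let $\psi_{AB}=|\psi\rangle\langle\psi|_{AB}$ be a pure bipartite state on $\mathcal{H}_A\otimes\mathcal{H}_B$, let $\rho_B:=\operatorname{Tr}_A[\psi_{AB}]$, and let $k\ge 1$ be an integer. Then the acceptance probability $p^{(k)}$ of the bipartite pure-state separability test is given by $$p^{(k)}=\sum_{a_1+2a_2+\cdots+ka_k=k}\ \prod_{j=1}^k\frac{(\operatorname{Tr}[\rho_B^j])^{a_j}}{j^{a_j}\,a_j!},$$ where the sum is over all tuples $(a_1,\dots,a_k)$ of nonnegative integers with $a_1+2a_2+\cdots+ka_k=k$ (i.e. over the partitions of $k$).
   Context: $\mathcal{H}_A,\mathcal{H}_B$ are finite-dimensional complex Hilbert spaces; a pure state is a rank-one projection $|\psi\rangle\langle\psi|$ with $|\psi\rangle$ a unit vector, and $\operatorname{Tr}_A$ is the partial trace over $\mathcal{H}_A$. For $\pi\in S_k$, $W_{B_1\cdots B_k}(\pi)$ is the unitary on $\mathcal{H}_B^{\otimes k}$ permuting the tensor factors: $W_{B_1\cdots B_k}(\pi)(v_1\otimes\cdots\otimes v_k)=v_{\pi^{-1}(1)}\otimes\cdots\otimes v_{\pi^{-1}(k)}$. The acceptance probability of the bipartite pure-state separability test with $k$ copies is $$p^{(k)}:=\operatorname{Tr}[\Pi_{B_1\cdots B_k}\,\rho_B^{\otimes k}],\qquad \Pi_{B_1\cdots B_k}:=\frac{1}{k!}\sum_{\pi\in S_k}W_{B_1\cdots B_k}(\pi).$$ *)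

(* Defs.v *)
From mathcomp Require Import all_boot all_order all_fingroup all_algebra.
From mathcomp Require Import mxtens.

Set Implicit Arguments.
Unset Strict Implicit.
Unset Printing Implicit Defensive.

Import GRing.Theory.
Local Open Scope ring_scope.
Local Open Scope sesquilinear_scope.

(* Finite-dimensional Hilbert spaces are taken to be C^n with the standard
   inner product, vectors being columns.  C^m (x) C^n is C^(m * n), with the
   indexing of [tensmx]. *)

(* The projection |psi><psi| when psi is a unit vector. *)
Definition ketbra (C : numClosedFieldType) (n : nat) (psi : 'cV[C]_n) :
  'M[C]_n := psi *m psi^t*.

Definition ptraceA (C : numClosedFieldType) (m n : nat) (X : 'M[C]_(m * n)) :
  'M[C]_n :=
  \matrix_(i, j) \sum_(a < m) X (mxtens_index (a, i)) (mxtens_index (a, j)).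

(* The k-fold tensor power of C^n has its standard basis indexed by the
   multi-indices f : {ffun 'I_k -> 'I_n}, which enum_val/enum_rank put in
   bijection with the ordinals below tpdim n k. *)
Definition tpdim (n k : nat) : nat := #|{ffun 'I_k -> 'I_n}|.

Definition tensv (C : numClosedFieldType) (n k : nat) (v : 'I_k -> 'cV[C]_n) :
  'cV[C]_(tpdim n k) :=
  \col_x \prod_(i < k) v i ((enum_val x : {ffun _}) i) ord0.

Definition tensop (C : numClosedFieldType) (n k : nat) (A : 'I_k -> 'M[C]_n) :
  'M[C]_(tpdim n k) :=
  \matrix_(x, y)
    \prod_(i < k) A i ((enum_val x : {ffun _}) i) ((enum_val y : {ffun _}) i).

Definition tensop_pow (C : numClosedFieldType) (n k : nat) (A : 'M[C]_n) :
  'M[C]_(tpdim n k) := tensop (fun _ : 'I_k => A).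

(* W pi maps the basis vector e_g to e_(g \o pi^-1); see [permop_tensv] for its
   action on arbitrary product vectors. *)
Definition permop (C : numClosedFieldType) (n k : nat) (pi : 'S_k) :
  'M[C]_(tpdim n k) :=
  \matrix_(x, y)
    ((enum_val x : {ffun 'I_k -> 'I_n})
       == [ffun i => (enum_val y : {ffun _}) ((pi^-1)%g i)])%:R.

Definition sym_proj (C : numClosedFieldType) (n k : nat) :
  'M[C]_(tpdim n k) :=
  (k`!%:R)^-1 *: \sum_(pi : 'S_k) permop C n pi.

Definition accept_prob (C : numClosedFieldType) (n k : nat) (rho : 'M[C]_n) :
  C := \tr (sym_proj C n k *m tensop_pow k rho).

Lemma ptraceA_tens (C : numClosedFieldType) (m n : nat)
  (A : 'M[C]_m) (B : 'M[C]_n) : ptraceA (tensmx A B) = \tr A *: B.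
Proof.
apply/matrixP=> i j; rewrite !mxE /mxtrace mulr_suml.
by apply: eq_bigr => a _; rewrite !mxE !mxtens_indexK.
Qed.

Lemma tensop_tensv (C : numClosedFieldType) (n k : nat)
  (A : 'I_k -> 'M[C]_n) (v : 'I_k -> 'cV[C]_n) :
  tensop A *m tensv v = tensv (fun i => A i *m v i).
Proof.
apply/matrixP=> x j; rewrite !mxE.
under [RHS]eq_bigr => i _ do rewrite mxE.
rewrite bigA_distr_bigA /= (reindex_onto enum_rank enum_val) => [|y _];
  last exact: enum_valK.
apply: eq_big => [f|f _]; first by rewrite enum_rankK eqxx.
by rewrite !mxE enum_rankK big_split.
Qed.

Lemma permop_tensv (C : numClosedFieldType) (n k : nat) (pi : 'S_k)
  (v : 'I_k -> 'cV[C]_n) :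
  permop C n pi *m tensv v = tensv (fun i => v ((pi^-1)%g i)).
Proof.
apply/matrixP=> x j; rewrite !mxE.
pose f : {ffun 'I_k -> 'I_n} := [ffun i => (enum_val x : {ffun _}) (pi i)].
rewrite (bigD1 (enum_rank f)) //= big1 ?addr0 => [|y neq_yf].
  rewrite !mxE enum_rankK.
  have -> : enum_val x == [ffun i => f ((pi^-1)%g i)].
    by apply/eqP/ffunP=> i; rewrite !ffunE permKV.
  rewrite mul1r [RHS](reindex_inj (@perm_inj _ pi)) /=.
  by apply: eq_bigr => i _; rewrite ffunE permK.
rewrite !mxE; case: eqP => [xy|_]; last by rewrite mul0r.
case/eqP: neq_yf; apply: enum_val_inj; rewrite enum_rankK.
by apply/ffunP=> i; rewrite ffunE xy ffunE permK.
Qed.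

(* Tuples (a_1, ..., a_k) with sum_j j * a_j = k are indexed from 0, i.e. a j
   stands for a_(j+1).  By [cycle_type_bound] such entries are at most k, so
   'I_k.+1 is a lossless range for them. *)
Definition is_cycle_type (k : nat) (a : {ffun 'I_k -> 'I_k.+1}) : bool :=
  (\sum_(j < k) j.+1 * a j == k)%N.

Lemma cycle_type_bound (k : nat) (a : 'I_k -> nat) :
  (\sum_(j < k) j.+1 * a j = k)%N -> forall j, (a j < k.+1)%N.
Proof.
move=> sum_a j; rewrite ltnS -[leqRHS]sum_a (bigD1 j) //=.
by apply: leq_trans (leq_addr _ _); rewrite leq_pmull.
Qed.

(* Main.v *)
(* With [T k] the sum over pi in S_k of tr (W pi rho^(x)k), contracting the
   first tensor factor shows that [Z k = T k / k!] satisfies Newton's recurrence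
   [k Z k = \sum_(1 <= j <= k) tr (rho^j) Z (k - j)].  The sum over cycle types
   satisfies the same one, as is seen by multiplying its terms by
   [k = \sum_j j a_j] and lowering a_j by one. *)
Require Import Defs.
From mathcomp Require Import all_boot all_order all_fingroup all_algebra.
From mathcomp Require Import complex reals ring.

Set Implicit Arguments.
Unset Strict Implicit.
Unset Printing Implicit Defensive.

Import GRing.Theory.
Local Open Scope ring_scope.
Local Open Scope sesquilinear_scope.
Local Open Scope complex_scope.

(** * Traces over permutations and contraction of a tensor factor *)

(** The summand at [s] is the trace of [tensop A] times W(s^-1). The operators may differ, since
    contracting a factor creates products. *)
Definition trace_sum (C : comNzRingType) (n k : nat) (A : 'I_k -> 'M[C]_n) : C :=
  \sum_(s : 'S_k) \sum_(f : {ffun 'I_k -> 'I_n})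
    \prod_(i < k) A i (f i) (f (s i)).

Lemma trace_sum0 (C : comNzRingType) (n : nat) (A : 'I_0 -> 'M[C]_n) :
  trace_sum A = 1.
Proof.
rewrite /trace_sum; under eq_bigr => s _ do under eq_bigr => f _ do rewrite big_ord0.
by rewrite !sumr_const card_Sn card_ffun !card_ord.
Qed.

Lemma eq_trace_sum (C : comNzRingType) (n k : nat) (A B : 'I_k -> 'M[C]_n) :
  A =1 B -> trace_sum A = trace_sum B.
Proof.
move=> eqAB; apply: eq_bigr => s _; apply: eq_bigr => f _.
by apply: eq_bigr => i _; rewrite eqAB.
Qed.

(** Relabelling the tensor factors by [t] amounts to conjugating [s] by [t] and composing the
    multi-indices with [t]. *)
Lemma trace_sum_perm (C : comNzRingType) (n k : nat) (A : 'I_k -> 'M[C]_n)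
  (t : 'S_k) : trace_sum (A \o t) = trace_sum A.
Proof.
rewrite /trace_sum [RHS](reindex_inj (conjg_inj t)) /=; apply: eq_bigr => s _.
pose h (u : 'S_k) (f : {ffun 'I_k -> 'I_n}) := [ffun i => f (u i)].
have hK : cancel (h t^-1%g) (h t).
  by move=> f; apply/ffunP=> i; rewrite !ffunE permK.
rewrite [RHS](reindex_inj (can_inj hK)) /=; apply: eq_bigr => f _.
rewrite [RHS](reindex_inj (@perm_inj _ t)) /=; apply: eq_bigr => i _.
by rewrite !ffunE permK permJ permK.
Qed.

(** [ps.1] is the preimage of [ord0]: it is first swapped with [ord0], then a permutation fixing
    [ord0] acts. *)
Definition shift_perm (k : nat) (ps : 'I_k.+1 * 'S_k) : 'S_k.+1 :=
  (tperm ord0 ps.1 * lift_perm ord0 ord0 ps.2)%g.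

Lemma shift_perm_bij (k : nat) : bijective (@shift_perm k).
Proof.
apply: inj_card_bij; last by rewrite card_prod !card_Sn card_ord factS.
have root (p : 'I_k.+1) (s : 'S_k) : shift_perm (p, s) p = ord0.
  by rewrite permM tpermR lift_perm_id.
move=> [p s] [q t] eq_pq; have eqpq : p = q.
  by apply: (@perm_inj _ (shift_perm (p, s))); rewrite root eq_pq root.
move/permP in eq_pq; rewrite -{q}eqpq in eq_pq *; congr (_, _); apply/permP=> i.
have := eq_pq (tperm ord0 p (lift ord0 i)).
by rewrite !permM /= tpermK !lift_perm_lift => /lift_inj.
Qed.

Definition cons_ffun (T : Type) (k : nat) (bg : T * {ffun 'I_k -> T}) :
  {ffun 'I_k.+1 -> T} :=
  [ffun i => if unlift ord0 i is Some j then bg.2 j else bg.1].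

Lemma cons_ffun0 (T : Type) (k : nat) (bg : T * {ffun 'I_k -> T}) :
  cons_ffun bg ord0 = bg.1.
Proof. by rewrite ffunE unlift_none. Qed.

Lemma cons_ffunS (T : Type) (k : nat) (bg : T * {ffun 'I_k -> T}) (i : 'I_k) :
  cons_ffun bg (lift ord0 i) = bg.2 i.
Proof. by rewrite ffunE liftK. Qed.

Lemma cons_ffun_bij (T : Type) (k : nat) : bijective (@cons_ffun T k).
Proof.
exists (fun f : {ffun 'I_k.+1 -> T} =>
  (f ord0, [ffun j : 'I_k => f (lift ord0 j)])) => [[b g]|f].
  by rewrite cons_ffun0; congr (_, _); apply/ffunP=> i; rewrite ffunE cons_ffunS.
apply/ffunP=> i; case: (unliftP ord0 i) => [j|] ->.
  by rewrite cons_ffunS ffunE.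
by rewrite cons_ffun0.
Qed.

(* The first summand collects the permutations fixing [ord0]; in those with
   pi (lift ord0 q) = ord0, summing over the index at [ord0] merges the two
   factors A (lift ord0 q) and A ord0 into a single one. *)
Lemma trace_sumS (C : comNzRingType) (n k : nat) (A : 'I_k.+1 -> 'M[C]_n) :
  trace_sum A =
    \tr (A ord0) * trace_sum (A \o lift ord0) +
    \sum_(q < k) trace_sum (fun j =>
      if j == q then A (lift ord0 q) *m A ord0 else A (lift ord0 j)).
Proof.
rewrite /trace_sum (reindex _ (onW_bij _ (shift_perm_bij k))) /=.
rewrite -(pair_bigA _ (fun p s =>
  \sum_(f : {ffun 'I_k.+1 -> 'I_n}) \prod_i A i (f i)
  (f (shift_perm (p, s) i)))) /=.
(* The index [b] at [ord0] is summed innermost, ready to become a trace or the inner index of a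
   matrix product. *)
have split_f (s : 'S_k.+1) :
    \sum_(f : {ffun 'I_k.+1 -> 'I_n}) \prod_i A i (f i) (f (s i)) =
    \sum_(g : {ffun 'I_k -> 'I_n}) \sum_b
      A ord0 b (cons_ffun (b, g) (s ord0)) *
      \prod_i A (lift ord0 i) (g i) (cons_ffun (b, g) (s (lift ord0 i))).
  rewrite exchange_big /= pair_bigA /=.
  rewrite (reindex _ (onW_bij _ (@cons_ffun_bij 'I_n k))) /=.
  apply: eq_bigr => -[b g] _; rewrite big_ord_recl cons_ffun0 /=.
  by congr (_ * _); apply: eq_bigr => i _; rewrite cons_ffunS.
rewrite big_ord_recl; congr (_ + _).
  rewrite mulr_sumr; apply: eq_bigr => s _; rewrite split_f mulr_sumr.
  apply: eq_bigr => g _; rewrite mulr_suml; apply: eq_bigr => b _.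
  rewrite permM /= tperm1 perm1 lift_perm_id cons_ffun0; congr (_ * _).
  by apply: eq_bigr => i _; rewrite permM /= tperm1 perm1 lift_perm_lift cons_ffunS.
apply: eq_bigr => q _; apply: eq_bigr => s _; rewrite split_f.
apply: eq_bigr => g _; rewrite [RHS](bigD1 q) //= eqxx mxE mulr_suml.
apply: eq_bigr => b _; rewrite permM tpermL lift_perm_lift cons_ffunS.
rewrite (bigD1 q) //= permM tpermR lift_perm_id cons_ffun0 mulrA.
congr (_ * _); first by rewrite mulrC.
apply: eq_bigr => i neq_iq; rewrite (negPf neq_iq) permM tpermD //=.
  by rewrite lift_perm_lift cons_ffunS.
by rewrite (inj_eq lift_inj) eq_sym.
Qed.

Definition marked (T : Type) (k : nat) (A B : T) (p i : 'I_k) : T :=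
  if i == p then B else A.

Lemma trace_sum_marked (C : comNzRingType) (n k : nat) (A B : 'M[C]_n)
  (p q : 'I_k) : trace_sum (marked A B p) = trace_sum (marked A B q).
Proof.
rewrite -(trace_sum_perm _ (tperm p q)); apply: eq_trace_sum => i /=.
by rewrite /marked -{2}(tpermR p q) (inj_eq perm_inj).
Qed.

(** * Newton's recurrence for the normalized trace sums *)

Section TraceRecurrence.
Variables (C : numFieldType) (n : nat) (A : 'M[C]_n).

Definition normalized_trace_sum (k : nat) : C :=
  trace_sum (fun _ : 'I_k => A) / k`!%:R.

(** The power on the marked factor is kept general for the induction: contracting that factor either
    closes it into a trace or merges it with a plain [A], which raises the power by one. *)
Lemma marked_recurrence (k m : nat) :
  trace_sum (marked A (A ^+ m.+1) (ord0 : 'I_k.+1)) / k`!%:R =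
  \sum_(j < k.+1) \tr (A ^+ (m + j).+1) * normalized_trace_sum (k - j).
Proof.
elim: k m => [|k IHk] m; rewrite trace_sumS /=.
  rewrite big_ord0 big_ord1 addr0 addn0 /normalized_trace_sum -mulrA.
  by congr (_ * (_ / _)); rewrite !trace_sum0.
rewrite [in RHS]big_ord_recl /= addn0 subn0 mulrDl -mulrA; congr (_ + _).
(* By symmetry every merged factor can be moved to [ord0]; the number of these equal terms then
   cancels against the factorial. *)
under eq_bigr => q _.
  rewrite (@eq_trace_sum _ _ _ _ (marked A (A ^+ m.+2) q)) => [|i].
    rewrite (trace_sum_marked _ _ q ord0); over.
  by rewrite /marked /= [in RHS]exprS.
rewrite sumr_const card_ord factS -[X in X / _]mulr_natl natrM invfM.
rewrite mulrACA divff ?Num.Theory.pnatr_eq0 // mul1r IHk.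
by apply: eq_bigr => j _; rewrite /bump leq0n add1n addSnnS subSS.
Qed.

Lemma normalized_trace_sum_recurrence (m : nat) :
  m.+1%:R * normalized_trace_sum m.+1 =
  \sum_(j < m.+1) \tr (A ^+ j.+1) * normalized_trace_sum (m - j).
Proof.
(* The marked power is here [A ^+ 1], so all factors are equal. *)
rewrite -(marked_recurrence m 0) /normalized_trace_sum factS natrM invfM.
rewrite mulrCA mulVKf ?Num.Theory.pnatr_eq0 //; congr (_ / _).
by apply: eq_trace_sum => i; rewrite /marked expr1 if_same.
Qed.

End TraceRecurrence.

(** In the standard basis each column of [permop] has a single nonzero entry, which leaves the
    [trace_sum] term of the inverse permutation; summing over the group absorbs the inversion. *)
Lemma accept_probE (C : numClosedFieldType) (n k : nat) (rho : 'M[C]_n) :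
  accept_prob k rho = normalized_trace_sum rho k.
Proof.
rewrite /accept_prob /sym_proj -scalemxAl linearZ /= mulrC mulmx_suml raddf_sum /=.
congr (_ / _); rewrite [RHS](reindex_inj invg_inj) /=; apply: eq_bigr => s _.
rewrite mxtrace_mulC /mxtrace.
rewrite (reindex _ (onW_bij _ (@enum_rank_bij {ffun 'I_k -> 'I_n}))) /=.
apply: eq_bigr => f _; rewrite mxE.
rewrite (bigD1 (enum_rank [ffun i => f ((s^-1)%g i)])) //= big1 ?addr0 => [|y neq_y].
  by rewrite !mxE !enum_rankK eqxx mulr1; apply: eq_bigr => i _; rewrite ffunE.
rewrite !mxE enum_rankK; case: eqP => [eq_y|_]; last by rewrite mulr0.
by rewrite -eq_y enum_valK eqxx in neq_y.
Qed.

(** * Cycle types and the recurrence for their generating sum *)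

Definition weight (N : nat) (a : {ffun 'I_N -> 'I_N.+1}) : nat :=
  (\sum_(j < N) j.+1 * a j)%N.

(* Overflowing entries of [incr] wrap to 0 and lowering 0 leaves it unchanged. *)
Definition incr (N : nat) (j : 'I_N) (a : {ffun 'I_N -> 'I_N.+1}) :
  {ffun 'I_N -> 'I_N.+1} := [ffun i => inord (a i + (i == j))%N].

Definition decr (N : nat) (j : 'I_N) (a : {ffun 'I_N -> 'I_N.+1}) :
  {ffun 'I_N -> 'I_N.+1} := [ffun i => inord (a i - (i == j))%N].

Lemma incr_val (N : nat) (j : 'I_N) (a : {ffun 'I_N -> 'I_N.+1}) (i : 'I_N) :
  (a j < N)%N -> incr j a i = (a i + (i == j))%N :> nat.
Proof.
move=> lt_aj; rewrite ffunE inordK //; case: eqP => [->|_]; first by rewrite addn1.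
by rewrite addn0.
Qed.

Lemma incrK (N : nat) (j : 'I_N) (a : {ffun 'I_N -> 'I_N.+1}) :
  (a j < N)%N -> decr j (incr j a) = a.
Proof.
move=> lt_aj; apply/ffunP=> i; apply: val_inj.
by rewrite /= ffunE incr_val // addnK inordK.
Qed.

Lemma decr_lt (N : nat) (j : 'I_N) (a : {ffun 'I_N -> 'I_N.+1}) :
  (decr j a j < N)%N.
Proof.
have le_aN : ((a j).-1 < N)%N.
  have gt0_N := leq_ltn_trans (leq0n j) (ltn_ord j).
  by case: (nat_of_ord (a j)) (ltn_ord (a j)).
by rewrite ffunE eqxx subn1 inordK // ltnS ltnW.
Qed.

Lemma decrK (N : nat) (j : 'I_N) (a : {ffun 'I_N -> 'I_N.+1}) :
  (0 < a j)%N -> incr j (decr j a) = a.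
Proof.
move=> gt0_aj; have decr_val i : decr j a i = (a i - (i == j))%N :> nat.
  by rewrite ffunE inordK // (leq_ltn_trans (leq_subr _ _)).
apply/ffunP=> i; apply: val_inj; rewrite /= incr_val ?decr_lt // decr_val.
by rewrite subnK //; case: eqP => [->|_].
Qed.

Lemma weight_incr (N : nat) (j : 'I_N) (a : {ffun 'I_N -> 'I_N.+1}) :
  (a j < N)%N -> weight (incr j a) = (weight a + j.+1)%N.
Proof.
move=> lt_aj; rewrite /weight; under eq_bigr => i _ do rewrite incr_val // mulnDr.
rewrite big_split /=; congr (_ + _)%N; rewrite (bigD1 j) //= eqxx muln1 big1 ?addn0 //.
by move=> i /negPf->; rewrite muln0.
Qed.

Lemma weight_ge (N : nat) (j : 'I_N) (a : {ffun 'I_N -> 'I_N.+1}) :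
  (j.+1 * a j <= weight a)%N.
Proof. by rewrite /weight (bigD1 j) //= leq_addr. Qed.

Section CycleIndex.
Variables (C : numFieldType) (N : nat) (x : nat -> C).

Definition cycle_term (a : {ffun 'I_N -> 'I_N.+1}) : C :=
  \prod_(j < N) (x j ^+ a j / ((j.+1)%:R ^+ a j * (a j)`!%:R)).

(** For [m <= N], this is the cycle index of S_m, with [x j] attached to cycles of length j+1.
    Fixing [N] while [m] varies keeps all these sums over one index type. *)
Definition cycle_index (m : nat) : C :=
  \sum_(a : {ffun 'I_N -> 'I_N.+1} | weight a == m) cycle_term a.

(** Raising [a j] by one multiplies the term by x_j / ((j+1)(a_j+1)), and the prefactor clears this
    denominator. *)
Lemma cycle_term_incr (j : 'I_N) (a : {ffun 'I_N -> 'I_N.+1}) :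
  (a j < N)%N ->
  (j.+1 * incr j a j)%:R * cycle_term (incr j a) = x j * cycle_term a.
Proof.
move=> lt_aj; rewrite /cycle_term (bigD1 j) // [in RHS](bigD1 j) //= !mulrA.
rewrite incr_val // eqxx addn1; congr (_ * _).
  rewrite factS !natrM !exprS.
  have nz (p : nat) : p.+1%:R != 0 :> C by rewrite Num.Theory.pnatr_eq0.
  have nzf : (a j)`!%:R != 0 :> C by rewrite Num.Theory.pnatr_eq0 -lt0n fact_gt0.
  by field; rewrite nzf expf_neq0 ?nz //= !nat1r !nz.
apply: eq_bigr => i /negPf neq_ij.
by rewrite incr_val // neq_ij addn0.
Qed.

Lemma cycle_index0 : cycle_index 0 = 1.
Proof.
rewrite /cycle_index (big_pred1 [ffun=> ord0]) => [|a /=].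
  by rewrite /cycle_term big1 // => j _; rewrite ffunE !expr0 mulr1 divr1.
rewrite /weight sum_nat_eq0; apply/forallP/eqP => [a0|-> i]; last by rewrite ffunE muln0.
by apply/ffunP=> i; apply/val_inj; have := a0 i; rewrite muln_eq0 ffunE => /eqP.
Qed.

Lemma cycle_index_recurrence (m : nat) : (m < N)%N ->
  m.+1%:R * cycle_index m.+1 = \sum_(j < m.+1) x j * cycle_index (m - j).
Proof.
move=> lt_mN; rewrite (big_ord_widen N (fun j => x j * cycle_index (m - j))) //.
(* The factor m+1 is expanded as the weight of [a]; entries with [a j = 0] contribute nothing. *)
have -> : m.+1%:R * cycle_index m.+1 = \sum_(j < N)
    \sum_(a : {ffun 'I_N -> 'I_N.+1} | (weight a == m.+1) && (0 < a j)%N)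
      (j.+1 * a j)%:R * cycle_term a.
  rewrite mulr_sumr; under [RHS]eq_bigr => j _ do rewrite big_mkcondr.
  rewrite exchange_big /=; apply: eq_bigr => a /eqP<-.
  rewrite natr_sum mulr_suml; apply: eq_bigr => j _.
  by case: posnP => // ->; rewrite muln0 mul0r.
rewrite [RHS]big_mkcond /=; apply: eq_bigr => j _; rewrite ltnS.
(* For j > m, a positive [a j] would already give weight at least j+1 > m+1. *)
case: leqP => [le_jm|lt_mj]; last first.
  rewrite big1 // => a /andP[/eqP wa gt0_aj]; have := weight_ge j a.
  by rewrite wa leqNgt (leq_trans _ (leq_pmulr _ gt0_aj)).
rewrite (reindex_onto (incr j) (decr j)) => [|a /andP[_ gt0_aj]]; last exact: decrK.
rewrite /cycle_index mulr_sumr; apply: eq_big => [a|a].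
  (* Since m < N, no entry of a tuple of weight m-j reaches N, so [incr] does not wrap. *)
  have bounded b : weight b = (m - j)%N -> (b j < N)%N.
    move=> wb; apply: leq_ltn_trans lt_mN; apply: leq_trans (leq_subr j m).
    by rewrite -wb; apply: leq_trans (weight_ge j b); rewrite leq_pmull.
  apply/idP/eqP => [/andP[/andP[/eqP wa gt0] /eqP <-]|wa].
    by apply/eqP; rewrite -(eqn_add2r j.+1) -weight_incr ?decr_lt // decrK // wa addnS subnK.
  have lt_aj := bounded _ wa.
  by rewrite weight_incr // incrK // incr_val // wa addnS subnK // !eqxx addn1.
(* The reindexing condition [Ka] exhibits [a] as a lowered tuple, whence the bound on [a j]. *)
move=> /andP[/andP[_ gt0] /eqP Ka]; apply: cycle_term_incr.
by rewrite -Ka decr_lt.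
Qed.

End CycleIndex.

(** Both sides start at 1 and obey the same recurrence, which determines them because m+1 is
    invertible; it reaches back to all smaller indices, hence the strong induction. *)
Lemma normalized_trace_sumE (C : numFieldType) (n N : nat) (A : 'M[C]_n) (m : nat) :
  (m <= N)%N ->
  normalized_trace_sum A m = cycle_index N (fun j => \tr (A ^+ j.+1)) m.
Proof.
have [l] := ubnP m; elim: l m => // l IHl [_ _|m lt_ml lt_mN].
  by rewrite cycle_index0 /normalized_trace_sum trace_sum0 divr1.
have nz : m.+1%:R != 0 :> C by rewrite Num.Theory.pnatr_eq0.
apply: (mulfI nz); rewrite normalized_trace_sum_recurrence cycle_index_recurrence //.
apply: eq_bigr => j _; congr (_ * _); apply: IHl.
  exact: leq_ltn_trans (leq_subr j m) lt_ml.
exact: leq_trans (leq_subr j m) (ltnW lt_mN).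
Qed.

Theorem theorem2p2 (R : realType) (dA dB k : nat) (psi : 'cV[R[i]]_(dA * dB))
  (psi_unit : psi^t* *m psi = 1%:M) (k_ge1 : (1 <= k)%N) :
  let rhoB := ptraceA (ketbra psi) in
  accept_prob k rhoB =
  \sum_(a : {ffun 'I_k -> 'I_k.+1} | is_cycle_type a)
    \prod_(j < k)
      ((\tr (rhoB ^+ j.+1)) ^+ a j / ((j.+1)%:R ^+ a j * (a j)`!%:R)).
(* With N = m = k, the condition [weight a == m] is [is_cycle_type a] by conversion. *)
Proof. by move=> rhoB; rewrite accept_probE (normalized_trace_sumE _ (leqnn k)). Qed.
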